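(* Let $S$ be a commutative antiring, let $n\ge 1$, and let $A\in M_n(S)$. Then $A$ is invertible in $M_n(S)$ if and only if there exist an invertible diagonal matrix $D\in M_n(S)$ and elements $a_\sigma\in S$ ($\sigma\in S_n$) with $\sum_{\sigma\in S_n}a_\sigma=1$ and $a_\sigma a_\tau=0$ for all $\sigma\neq\tau$ in $S_n$ (some of the $a_\sigma$ may be zero), such that $$A=D\sum_{\sigma\in S_n}a_\sigma P_\sigma ,$$ where $P_\sigma$ denotes the $n\times n$ permutation matrix of $\sigma$.
   Context: A semiring is a set $S$ with operations $+$ and $\cdot$ such that $(S,+)$ is a commutative monoid with identity $0$, $(S,\cdot)$ is a monoid with identity $1$, multiplication distributes over addition, and $0\cdot a=a\cdot 0=0$ for all $a\in S$. It is commutative if $ab=ba$ for all $a,b\in S$. An antiring is a semiring $S$ that is zerosumfree: $a+b=0$ implies $a=b=0$ for all $a,b\in S$. $M_n(S)$ is the semiring of $n\times n$ matrices over $S$; $S_n$ is the symmetric group on $\{1,\dots,n\}$. A permutation matrix has entries $0$ and $1$ with exactly one $1$ in each row and column. *)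

(* Defs.v *)
From mathcomp Require Import all_boot all_order all_fingroup all_algebra.

Set Implicit Arguments.
Unset Strict Implicit.
Unset Printing Implicit Defensive.

Import GRing.Theory.
Local Open Scope ring_scope.

(* A semiring is a [pzSemiRingType]: 1 = 0 is allowed. *)

Definition zerosumfree (S : pzSemiRingType) : Prop :=
  forall a b : S, a + b = 0 -> a = 0 /\ b = 0.

(* The library's [unitmx] needs a ring and a determinant, so invertibility over
   a semiring is the existence of a two-sided inverse. *)
Definition invertible_mx (S : pzSemiRingType) (n : nat) (A : 'M[S]_n) : Prop :=
  exists B : 'M[S]_n, A *m B = 1%:M /\ B *m A = 1%:M.

(* Main.v *)
Require Import Defs.
From mathcomp Require Import all_boot all_order all_fingroup all_algebra.

Set Implicit Arguments.
Unset Strict Implicit.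
Unset Printing Implicit Defensive.

Import GRing.Theory.
Local Open Scope ring_scope.

(** If A B = B A = 1, zerosumfreeness turns every vanishing off-diagonal entry
    of A B and B A into A_ik B_kj = B_ik A_kj = 0 for i <> j.  Hence the
    e_ij = A_ij B_ji are idempotents, orthogonal along each row and column, with
    row sums 1, and A_ij = d_i e_ij where d_i is the i-th row sum of A, with
    inverse the i-th column sum of B.  Expanding the product over i of the row
    sums of e, the non-injective functions contribute 0, so the products
    a_s = prod_i e_(i, s i) are orthogonal, sum to 1, and decompose e. *)

Lemma zerosumfree_sum (S : pzSemiRingType) (hS : zerosumfree S) (I : finType)
    (F : I -> S) : \sum_i F i = 0 -> forall i, F i = 0.
Proof. by move=> F0 i; move: F0; rewrite (bigD1 i) //= => /hS[]. Qed.

Lemma mulmx_scalar_offdiag (S : pzSemiRingType) (hS : zerosumfree S) (n : nat)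
    (A B : 'M[S]_n) (c : S) :
  A *m B = c%:M -> forall i j k, i != j -> A i k * B k j = 0.
Proof.
move=> AB i j k neq_ij; apply: (zerosumfree_sum hS (F := fun k => A i k * B k j)).
by have /matrixP/(_ i j) := AB; rewrite !mxE (negPf neq_ij).
Qed.

(** Expanding [x * 1] along the sum leaves one term. With [x = e i] this gives idempotence of an
    orthogonal family of sum 1. *)
Lemma mulr_sum1_id (S : pzSemiRingType) (I : finType) (e : I -> S) (i : I) (x : S) :
  \sum_j e j = 1 -> (forall j, j != i -> x * e j = 0) -> x * e i = x.
Proof.
move=> e1 xe; rewrite -[RHS]mulr1 -e1 mulr_sumr (bigD1 i) //=.
by rewrite big1 ?addr0 // => j /xe.
Qed.

Lemma invertible_mxM (S : pzSemiRingType) (n : nat) (A B : 'M[S]_n) :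
  invertible_mx A -> invertible_mx B -> invertible_mx (A *m B).
Proof.
move=> [A' [AA' A'A]] [B' [BB' B'B]]; exists (B' *m A'); split.
  by rewrite mulmxA -(mulmxA A) BB' mulmx1.
by rewrite mulmxA -(mulmxA B') A'A mulmx1.
Qed.

(** The inverse is the same combination of the inverse permutations: orthogonality kills the cross
    terms, and idempotence leaves [a s] times the identity. *)
Lemma orthogonal_perm_mx_invertible (S : comPzSemiRingType) (n : nat)
    (a : 'S_n -> S) :
  \sum_s a s = 1 -> (forall s t, s <> t -> a s * a t = 0) ->
  invertible_mx (\sum_s a s *: perm_mx s).
Proof.
move=> a1 a_orth.
have aK s : a s * a s = a s.
  by apply: mulr_sum1_id => // t /eqP ts; apply: a_orth => /esym.
(* Stated for a pair [f], [g] so as to serve both sides of the inverse. *)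
have prod_id (f g : 'S_n -> 'S_n) : (forall s, f s * g s = 1)%g ->
    (\sum_s a s *: perm_mx (f s)) *m (\sum_s a s *: perm_mx (g s)) = 1%:M :> 'M[S]_n.
  move=> fg; rewrite mulmx_suml -[RHS]scale1r -[X in _ = X *: _]a1 scaler_suml.
  apply: eq_bigr => s _; rewrite mulmx_sumr (bigD1 s) //= big1 => [|t ts].
    by rewrite addr0 -scalemxAl -scalemxAr scalerA aK -perm_mxM fg perm_mx1.
  rewrite -scalemxAl -scalemxAr scalerA a_orth ?scale0r //.
  by apply/eqP; rewrite eq_sym.
exists (\sum_s a s *: perm_mx s^-1%g).
split.
  by apply: (prod_id (fun s => s) (fun s => s^-1)%g) => s; rewrite mulgV.
by apply: (prod_id (fun s => s^-1)%g (fun s => s)) => s; rewrite mulVg.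
Qed.

Lemma orthogonal_stochastic_perm (S : comPzSemiRingType) (n : nat) (E : 'M[S]_n) :
  (forall i, \sum_j E i j = 1) ->
  (forall i j k, j != k -> E i j * E i k = 0) ->
  (forall i j k, i != j -> E i k * E j k = 0) ->
  exists a : 'S_n -> S,
    [/\ \sum_s a s = 1, forall s t, s <> t -> a s * a t = 0
      & E = \sum_s a s *: perm_mx s].
Proof.
move=> E1 Erow Ecol; pose a (s : 'S_n) := \prod_i E i (s i).
have a1 : \sum_s a s = 1.
  transitivity (\prod_i \sum_j E i j); last by rewrite big1.
  rewrite bigA_distr_bigA /=.
  rewrite (bigID (fun f : {ffun 'I_n -> 'I_n} => injectiveb f)) /=.
  rewrite [X in _ + X]big1 ?addr0 => [|f]; last first.
    case/injectivePn=> i [j neq_ij fij].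
    (* Rows [i] and [j] pick the same column, so [Ecol] annihilates the product. *)
    rewrite (bigD1 i) //= (bigD1 j) /=; last by rewrite eq_sym.
    by rewrite mulrA -fij Ecol // mul0r.
  rewrite (reindex (@pval _)) /=; last first.
    (* The default [1%g] is never reached, since only injective [f] are considered. *)
    pose in_Sn := insubd (1%g : 'S_n).
    by exists in_Sn => /= f Uf; first apply: val_inj; apply: insubdK.
  apply: eq_big => [s|s _]; first by rewrite (valP s).
  by apply: eq_bigr => i _; rewrite pvalE.
(* The factor [E i (s i)] of [a s] either absorbs [E i j] by idempotence or is orthogonal to it in
   row [i]. *)
have Ea i j (s : 'S_n) : E i j * a s = if s i == j then a s else 0.
  rewrite /a (bigD1 i) //= mulrA; case: eqP => [->|/eqP sij]; last first.
    by rewrite Erow ?mul0r // eq_sym.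
  by rewrite (mulr_sum1_id (E1 i)) // => k kj; rewrite Erow // eq_sym.
exists a; split=> // [s t /eqP neq_st|].
  have [i sti] : exists i, s i != t i.
    apply/existsP; apply: contraR neq_st; rewrite negb_exists => /forallP st.
    by apply/eqP/permP => i; apply/eqP/negPn.
  rewrite {1}/a (bigD1 i) //= mulrAC Ea eq_sym (negPf sti).
  by rewrite mul0r.
(* Multiplying [E i j] by [1 = \sum_s a s] selects, by [Ea], the [s] sending [i] to [j], just as the
   entries of [perm_mx s] do. *)
apply/matrixP=> i j; rewrite summxE -[LHS]mulr1 -a1 mulr_sumr.
apply: eq_bigr => s _; rewrite Ea !mxE.
by case: eqP => _; rewrite ?mulr1 ?mulr0.
Qed.

Lemma invertible_mx_factor (S : comPzSemiRingType) (hS : zerosumfree S) (n : nat)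
    (A : 'M[S]_n) : invertible_mx A ->
  exists D E : 'M[S]_n,
    [/\ is_diag_mx D, invertible_mx D & A = D *m E] /\
    [/\ forall i, \sum_j E i j = 1,
        forall i j k, j != k -> E i j * E i k = 0
      & forall i j k, i != j -> E i k * E j k = 0].
Proof.
move=> [B [AB BA]].
have AB0 := mulmx_scalar_offdiag hS AB; have BA0 := mulmx_scalar_offdiag hS BA.
have E1 i : \sum_j A i j * B j i = 1.
  by have /matrixP/(_ i i) := AB; rewrite !mxE eqxx.
pose d := \row_i \sum_k A i k; pose d' := \row_i \sum_l B l i.
have dd' i : d 0 i * d' 0 i = 1.
  (* In the double sum of [A i k * B l i], the terms with [l != k] are off-diagonal terms of
     [B *m A]; the others form row sum [i] of [e]. *)
  rewrite !mxE -[RHS](E1 i) mulr_suml; apply: eq_bigr => k _.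
  rewrite mulr_sumr (bigD1 k) //= big1 ?addr0 // => l lk.
  by rewrite mulrC BA0.
have diag_inv (u v : 'rV[S]_n) : (forall i, u 0 i * v 0 i = 1) ->
    diag_mx u *m diag_mx v = 1%:M.
  move=> uv; rewrite mulmx_diag; apply/matrixP=> i j.
  by rewrite !mxE uv.
exists (diag_mx d), (\matrix_(i, j) (A i j * B j i)); split; split.
- exact: diag_mx_is_diag.
- exists (diag_mx d'); split; apply: diag_inv => // i.
  by rewrite mulrC.
- rewrite mul_diag_mx; apply/matrixP=> i j; rewrite !mxE.
  (* In [d_i * e_ij] only [A i j * e_ij] survives, and [e_ij] fixes [A i j] because the other
     idempotents of row [i] kill it. *)
  rewrite mulr_suml (bigD1 j) //= big1 => [|k kj]; last first.
    by rewrite mulrCA [A i k * _]mulrC BA0 ?mulr0 // eq_sym.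
  rewrite addr0 (mulr_sum1_id (e := fun j => A i j * B j i)) // => k kj.
  by rewrite mulrCA [A i j * _]mulrC BA0 ?mulr0.
- by move=> i; rewrite -[RHS](E1 i); apply: eq_bigr => j _; rewrite mxE.
- by move=> i j k jk; rewrite !mxE -mulrA [B j i * _]mulrA BA0 // mul0r mulr0.
- by move=> i j k ij; rewrite !mxE [A j k * _]mulrC mulrACA AB0 // mul0r.
Qed.

Theorem theorem1 (S : comPzSemiRingType) (hS : zerosumfree S)
    (n : nat) (hn : (0 < n)%N) (A : 'M[S]_n) :
  invertible_mx A <->
  exists (D : 'M[S]_n) (a : 'S_n -> S),
    [/\ is_diag_mx D, invertible_mx D,
        \sum_(s : 'S_n) a s = 1,
        forall s t : 'S_n, s <> t -> a s * a t = 0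
      & A = D *m \sum_(s : 'S_n) a s *: perm_mx s].
Proof.
split=> [/(invertible_mx_factor hS)[D [E [[Ddiag Dinv ->] [E1 Erow Ecol]]]]|].
  have [a [a1 a_orth ->]] := orthogonal_stochastic_perm E1 Erow Ecol.
  by exists D, a.
move=> [D [a [_ Dinv a1 a_orth ->]]].
by apply: invertible_mxM => //; apply: orthogonal_perm_mx_invertible.
Qed.
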